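(* Let $X$ be a countable discrete field of characteristic $p$, where $p>2$. Let $\xi$ and $\eta$ be independent identically distributed random variables with values in $X$ and distribution $\mu$. The random variables $S=\xi+\eta$ and $D=(\xi-\eta)^2$ are independent if and only if $\mu\in I(X)$, i.e. $\mu$ is an idempotent distribution on $X$.
   Context: A discrete field is a field with the discrete topology; its additive group, also denoted $X$, is a discrete (hence locally compact) Abelian group. For a compact subgroup $K$ of $X$ (compact means finite, as $X$ is discrete), $m_K$ denotes the Haar distribution of $K$, i.e. the Haar measure on $K$ normalized by $m_K(K)=1$ and regarded as a probability measure on $X$. $I(X)$ denotes the set of all idempotent distributions on $X$, i.e. the set of all shifts (translates by elements of $X$) of Haar distributions $m_K$ of compact subgroups $K$ of the additive group $X$. The sum, difference and square are those of the field $X$. *)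

(* Defs.v *)
From HB Require Import structures.
From mathcomp Require Import all_boot all_order all_algebra.
From mathcomp Require Import all_classical all_reals all_analysis.

Set Implicit Arguments.
Unset Strict Implicit.
Unset Printing Implicit Defensive.

Import Order.TTheory GRing.Theory Num.Theory.

Local Open Scope classical_set_scope.
Local Open Scope ring_scope.

(* Alias of a field [X] carrying the discrete topology and the sigma-algebra of
   all subsets, which is the Borel sigma-algebra of that topology. *)
Definition discrete_field (X : fieldType) : Type := X.

HB.instance Definition _ (X : fieldType) :=
  GRing.Field.copy (discrete_field X) X.
HB.instance Definition _ (X : fieldType) :=
  isPointed.Build (discrete_field X) 0.
HB.instance Definition _ (X : fieldType) :=
  DiscreteTopology.copy (discrete_field X) (discrete_topology X).
HB.instance Definition _ (X : fieldType) :=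
  @isMeasurable.Build default_measure_display (discrete_field X)
    discrete_measurable discrete_measurable0
    discrete_measurableC discrete_measurableU.

Definition independent_RVs d d1 d2 (T : measurableType d)
    (T1 : measurableType d1) (T2 : measurableType d2) (R : realType)
    (P : probability T R) (U : T -> T1) (V : T -> T2) : Prop :=
  forall (A : set T1) (B : set T2), measurable A -> measurable B ->
    P (U @^-1` A `&` V @^-1` B) = (P (U @^-1` A) * P (V @^-1` B))%E.

Section idempotent.
Variables (R : realType) (X : fieldType).
Local Notation G := (discrete_field X).
Implicit Types (K : set G) (m mu : probability G R).

Definition compact_subgroup K : Prop := zmod_closed [in K] /\ compact K.

(* [m K = 1] makes [m] the extension by zero to [G] of a probability on [K]. *)
Definition is_haar_distribution K m : Prop :=
  m K = 1%E /\
  forall (x : G) (A : set G), K x -> A `<=` K -> measurable A ->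
    m [set x + a | a in A] = m A.

Definition idempotent_distribution mu : Prop :=
  exists K m (x : G),
    [/\ compact_subgroup K, is_haar_distribution K m
      & forall A : set G, measurable A ->
          mu A = pushforward m (fun y : G => x + y) A].

End idempotent.

(* Main.v *)
Require Import Defs.
From HB Require Import structures.
From mathcomp Require Import all_boot all_order all_algebra finmap.
From mathcomp Require Import all_classical all_reals all_analysis.
From mathcomp Require Import ring.

(** Write [f] for the point masses of [mu]. Since the characteristic is not 2,
    knowing the sum and the squared difference of two field elements is knowing
    the unordered pair, so the event [S = x + y], [D = (x - y) ^+ 2] has
    probability [2 f(x) f(y)] for [x <> y] and [f(x) ^+ 2] for [x = y].

    Independence of [S] and [D] implies idempotence. Independence writes these
    numbers as products [g(x + y) * h((x - y) ^+ 2)]; eliminating [g] and [h]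
    leaves, around any base point [a], the Kac-Bernstein type equation
      [F(u + v) F(u - v) F(0)^2 = F(u)^2 F(v) F(-v)],  [F(u) = f(a + u)]
    ([point_mass_functional_equation]). Take [a] with [f(a) > 0]. As elements
    can be halved, the equation makes the support of [F] a subgroup
    ([functional_equation_supportB]). Along the multiples of an element [u] of
    the support, it says that [log F] has constant second difference; in
    characteristic [p] this sequence is periodic, hence constant
    ([functional_equation_const]). So [mu] gives the same mass to all points of
    a coset and none to the others; the total mass being 1, the coset is finite,
    and [mu] is a shifted Haar distribution
    ([idempotent_of_constant_on_coset]).

    Idempotence implies independence. If [f] is a constant [c] on [a + K] and 0
    elsewhere, then [S] has mass [c] at each point of [2 a + K] and [xi - eta]
    has mass [c] at each point of [K]. Since [K] is closed under halving,
    [x] and [y] lie in [a + K] exactly when [x + y] lies in [2 a + K] and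
    [x - y] in [K]. Hence [S] is independent even of [xi - eta], and so of its
    square ([independent_sum_diff_idempotent]).

    Sums over the countable field all enter through one law of total
    probability, [measure_fiberwise]. *)

Set Implicit Arguments.
Unset Strict Implicit.
Unset Printing Implicit Defensive.

Import Order.TTheory GRing.Theory Num.Theory.

Local Open Scope classical_set_scope.
Local Open Scope ring_scope.

(** * The functional equation *)

(** The ratio [r k = b k.+1 / b k] is geometric with factor [Q]. Periodicity
    of [r] gives [Q ^+ p = 1], so [Q = 1] and [r] is constant; periodicity of
    [b] then gives [r ^+ p = 1], so [r = 1]. *)
Lemma periodic_geometric_ratio_const (R : realFieldType) (b : nat -> R) (Q : R)
    (p : nat) (p_gt0 : (0 < p)%N) (b_gt0 : forall k, 0 < b k)
    (b_periodic : forall k, b (k + p)%N = b k)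
    (b_eq : forall k, b k.+2 * b k = Q * b k.+1 ^+ 2) :
  b 1%N = b 0%N.
Proof.
have b_neq0 k : b k != 0 by rewrite gt_eqF.
pose r k := b k.+1 / b k.
have r_gt0 k : 0 < r k by rewrite divr_gt0.
have rS k : r k.+1 = Q * r k.
  apply: (mulIf (b_neq0 k)); apply: (mulIf (b_neq0 k.+1)).
  by rewrite /r mulrAC divfK// b_eq mulrA divfK//; ring.
have rE k : r k = Q ^+ k * r 0%N.
  by elim: k => [|k IH]; rewrite ?expr0 ?mul1r // rS IH exprS mulrA.
have Q_ge0 : 0 <= Q.
  by rewrite -(pmulr_lge0 _ (r_gt0 0%N)) -rS ltW.
have /eqP Q1 : Q == 1.
  rewrite -(pexpr_eq1 p_gt0 Q_ge0); apply/eqP/(mulIf (lt0r_neq0 (r_gt0 0%N))).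
  by rewrite -rE mul1r /r -[p]add0n -addSn !b_periodic.
have bE k : b k = r 0%N ^+ k * b 0%N.
  elim: k => [|k IH]; first by rewrite expr0 mul1r.
  have := rE k; rewrite Q1 expr1n mul1r => /(canRL (divfK (b_neq0 k))) ->.
  by rewrite IH exprS mulrA.
have /eqP r1 : r 0%N == 1.
  rewrite -(pexpr_eq1 p_gt0 (ltW (r_gt0 0%N))).
  apply/eqP/(mulIf (b_neq0 0%N)).
  by rewrite -bE mul1r -[p]add0n b_periodic.
by rewrite bE r1 expr1n mul1r.
Qed.

Lemma double_inj (X : fieldType) (x y : X) :
  2%:R != 0 :> X -> x + x = y + y -> x = y.
Proof.
move=> two_neq0; rewrite -!mulr2n -[x *+ 2]mulr_natr -[y *+ 2]mulr_natr.
exact: (mulIf two_neq0).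
Qed.

Lemma sum_sqdiff_inj (X : fieldType) (x y x' y' : X) : 2%:R != 0 :> X ->
    x + y = x' + y' -> (x - y) ^+ 2 = (x' - y') ^+ 2 ->
  (x = x' /\ y = y') \/ (x = y' /\ y = x').
Proof.
move=> two_neq0 sE /eqP; rewrite eqf_sqr => /orP[] /eqP dE; [left|right];
  have xE : x + x = (x + y) + (x - y) by ring.
- have yE : y + y = (x + y) - (x - y) by ring.
  by split; apply: (double_inj two_neq0); rewrite ?xE ?yE sE dE; ring.
- have yE : y + y = (x + y) - (x - y) by ring.
  by split; apply: (double_inj two_neq0); rewrite ?xE ?yE sE dE; ring.
Qed.

Section FunctionalEquation.
Variables (R : realFieldType) (X : fieldType) (F : X -> R).
Hypothesis two_neq0 : 2%:R != 0 :> X.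
Hypothesis F_ge0 : forall x, 0 <= F x.
Hypothesis F0_gt0 : 0 < F 0.
Hypothesis F_eq : forall u v,
  F (u + v) * F (u - v) * F 0 ^+ 2 = F u ^+ 2 * (F v * F (- v)).

Let pos2 x y : 0 < F x * F y -> 0 < F x /\ 0 < F y.
Proof.
by move=> h; have := F_ge0 x; have := F_ge0 y; split;
  rewrite lt_def F_ge0 andbT; apply: contraTneq h => ->;
  rewrite ?mul0r ?mulr0 ltxx.
Qed.

(* At [u = v = x / 2] the left-hand side of the equation is
   [F x * F 0 * F 0 ^+ 2]. *)
Let support_half x : 0 < F x -> 0 < F (x / 2%:R) /\ 0 < F (- (x / 2%:R)).
Proof.
move=> Fx; set h := x / 2%:R; apply: pos2.
have := F_eq h h; rewrite subrr.
have -> : h + h = x by rewrite /h; field.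
move=> E; have : 0 < F h ^+ 2 * (F h * F (- h)) by rewrite -E !mulr_gt0.
by rewrite pmulr_rgt0 // lt_def sqr_ge0 andbT expf_neq0 //;
  apply: contraTneq (mulr_gt0 (mulr_gt0 Fx F0_gt0) (exprn_gt0 2 F0_gt0)) => H0;
  rewrite E H0 !mul0r mulr0 ltxx.
Qed.

(** With [h = x / 2], the equation at [u = - h], [v = h] has the positive
    right-hand side [F (- h) ^+ 2 * (F h * F (- h))] and contains [F (- x)] on
    the left. *)
Lemma functional_equation_support_opp x : 0 < F x -> 0 < F (- x).
Proof.
move=> /support_half[]; set h := x / 2%:R => Fh FNh.
have := F_eq (- h) h; rewrite addNr.
have -> : - h - h = - x by rewrite /h; field.
move=> E; have : 0 < F 0 * F (- x) * F 0 ^+ 2.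
  by rewrite E; do !apply: mulr_gt0.
by rewrite pmulr_lgt0 ?exprn_gt0// pmulr_rgt0.
Qed.

(** Once the support is symmetric, the right-hand side at [u = x], [v = y] is
    positive, hence so is the factor [F (x - y)] on the left. *)
Lemma functional_equation_supportB x y : 0 < F x -> 0 < F y -> 0 < F (x - y).
Proof.
move=> Fx Fy; have FNy := functional_equation_support_opp Fy.
have : 0 < F (x + y) * F (x - y) * F 0 ^+ 2.
  by rewrite F_eq; do !apply: mulr_gt0.
by rewrite pmulr_lgt0 ?exprn_gt0// => /pos2[].
Qed.

(** The equation at [(k + 1) u] and [u] is the three-term relation of
    [periodic_geometric_ratio_const] for the sequence [F (k u)], which has
    period [p] because [p u = 0]. *)
Lemma functional_equation_const p u : p \in [pchar X] -> 0 < F u -> F u = F 0.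
Proof.
move=> pX Fu.
have F0_neq0 : F 0 != 0 by rewrite gt_eqF.
have Fmul k : 0 < F (u *+ k).
  elim: k => [|k IH]; first by rewrite mulr0n.
  rewrite mulrS addrC -[u in _ + u]opprK functional_equation_supportB //.
  exact: functional_equation_support_opp.
have := @periodic_geometric_ratio_const _ (fun k => F (u *+ k))
  (F u * F (- u) / F 0 ^+ 2) p.
  rewrite mulr1n mulr0n; apply => //.
  - exact/prime_gt0/(pcharf_prime pX).
  - by move=> k; rewrite mulrnDr (mulrn_pchar pX) addr0.
  - move=> k; apply: (mulIf (expf_neq0 2 F0_neq0)).
    have := F_eq (u *+ k.+1) u.
    rewrite -mulrSr (_ : u *+ k.+1 - u = u *+ k); last by rewrite mulrSr addrK.
    move=> ->.
    by field.
Qed.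

End FunctionalEquation.

(** * Measures along the fibers of a map to a countable set *)

Lemma measure_fiber_sum d (T : measurableType d) (R : realType) (G : Type)
    (P : {measure set T -> \bar R}) (Y : T -> G) (e : G -> nat) (E : set T) :
    measurable E -> (forall n, measurable (Y @^-1` (e @^-1` [set n]))) ->
  (P E = \sum_(n <oo) P (E `&` Y @^-1` (e @^-1` [set n])))%E.
Proof.
move=> mE mY; rewrite -measure_semi_bigcup.
- congr (P _); rewrite -setI_bigcupr; apply/seteqP; split=> [w Ew|w []//].
  by split=> //; exists (e (Y w)).
- by move=> n; exact: measurableI.
- by move=> i j _ _ [w [[_ /= <-] [_ /= <-]]].
- by apply: bigcup_measurable => n _; exact: measurableI.
Qed.

(** Total probability in the form of a comparison. It serves as a
    summation-free substitute for expanding over the points of [G]: [c = 0]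
    shows that a set is null, [c = 1] that two measures agree, and
    [c = P (V \in B)] turns a product rule at points into one for sets. *)
Lemma measure_fiberwise d d' (T : measurableType d) (T' : measurableType d')
    (R : realType) (G : Type) (P : {measure set T -> \bar R})
    (P' : {measure set T' -> \bar R}) (Y : T -> G) (Y' : T' -> G)
    (E : set T) (E' : set T') (c : R) :
    countable [set: G] -> measurable E -> measurable E' ->
    (forall B, measurable (Y @^-1` B)) -> (forall B, measurable (Y' @^-1` B)) ->
    (forall y, P (E `&` Y @^-1` [set y]) =
               c%:E * P' (E' `&` Y' @^-1` [set y]))%E ->
  (P E = c%:E * P' E')%E.
Proof.
move=> /countable_injP[e e_inj] mE mE' mY mY' h.
rewrite (@measure_fiber_sum _ _ _ _ P Y e)// (@measure_fiber_sum _ _ _ _ P' Y' e)//.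
rewrite -nneseriesZl//; apply: eq_eseriesr => n _.
(* The fiber of the injection [e] over [n] is a single point or empty. *)
have [[y yn]|no] := pselect (exists y, e y = n).
  suff -> : e @^-1` [set n] = [set y] by exact: h.
  apply/seteqP; split=> [z /= zn|z /= -> //].
  by apply: e_inj; rewrite ?inE// zn yn.
suff -> : e @^-1` [set n] = set0 by rewrite !preimage_set0 !setI0 !measure0 mule0.
by apply/seteqP; split=> [z /= zn|//]; apply: no; exists z.
Qed.

(** By countability of [G], the event is a countable union of rectangles. *)
Lemma measurable_preimage2 d (T : measurableType d) (G : Type) (U V : T -> G)
    (Z : set (G * G)) :
    countable [set: G] -> (forall A, measurable (U @^-1` A)) ->
    (forall A, measurable (V @^-1` A)) ->
  measurable [set w | Z (U w, V w)].
Proof.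
move=> /countable_injP[e e_inj] mU mV.
have -> : [set w | Z (U w, V w)] = \bigcup_n
    (U @^-1` [set x | exists2 y, e y = n & Z (x, y)] `&` V @^-1` (e @^-1` [set n])).
  apply/seteqP; split=> [w /= Zw|w [n _ [/= [y yn Zy] Vn]]].
    by exists (e (V w)) => //; split=> //=; exists (V w).
  by have <- : y = V w by apply: e_inj; rewrite ?inE// yn Vn.
by apply: bigcup_measurable => n _; exact: measurableI.
Qed.

Section DiscreteField.
Variables (R : realType) (X : fieldType).
Hypothesis X_countable : countable [set: X].
Local Notation G := (discrete_field X).

(** The product rule is extended from points to sets in one variable at a
    time, by summing first over the fibers of [V], then over those of [U]. *)
Lemma independent_RVs_pointwise d (T : measurableType d) (P : probability T R)
    (U V : T -> G) :
    (forall A, measurable (U @^-1` A)) -> (forall A, measurable (V @^-1` A)) ->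
    (forall s t, P (U @^-1` [set s] `&` V @^-1` [set t]) =
      P (U @^-1` [set s]) * P (V @^-1` [set t]))%E ->
  independent_RVs P U V.
Proof.
move=> mU mV h A B _ _.
have fin E : measurable E -> P E = (fine (P E))%:E.
  by move=> mE; rewrite fineK// fin_num_measure.
have hB s : (P (U @^-1` [set s] `&` V @^-1` B) =
    P (U @^-1` [set s]) * P (V @^-1` B))%E.
  rewrite [P (U @^-1` _) in RHS]fin//.
  apply: (@measure_fiberwise _ _ _ _ _ _ P P V V) => //; first exact: measurableI.
  move=> t; rewrite -fin// -setIA -preimage_setI.
  have [Bt|nBt] := pselect (B t).
    have -> : B `&` [set t] = [set t].
      by apply/seteqP; split=> [z []|z -> //].
    exact: h.
  have -> : B `&` [set t] = set0.
    by apply/seteqP; split=> [z [Bz zt]|//]; apply: nBt; rewrite -zt.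
  by rewrite preimage_set0 setI0 measure0 mule0.
rewrite muleC [P (V @^-1` _) in RHS]fin//.
apply: (@measure_fiberwise _ _ _ _ _ _ P P U U) => //; first exact: measurableI.
move=> s; rewrite -fin// setIAC -preimage_setI.
have [As|nAs] := pselect (A s).
  have -> : A `&` [set s] = [set s].
    by apply/seteqP; split=> [z []|z -> //].
  by rewrite muleC; exact: hB.
have -> : A `&` [set s] = set0.
  by apply/seteqP; split=> [z [Az zs]|//]; apply: nAs; rewrite -zs.
by rewrite preimage_set0 set0I measure0 mule0.
Qed.

(** * Point masses and idempotent distributions *)

Section PointMass.
Variable mu : probability G R.

Definition point_mass (x : G) : R := fine (mu [set x]).

Lemma point_massE x : mu [set x] = (point_mass x)%:E.
Proof. by rewrite /point_mass fineK// fin_num_measure. Qed.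

Lemma point_mass_ge0 x : 0 <= point_mass x.
Proof. by rewrite -lee_fin -point_massE. Qed.

Lemma null_of_point_masses (A : set G) :
  (forall x, A x -> point_mass x = 0) -> mu A = 0%E.
Proof.
move=> A0; rewrite -(mul0e (mu A)).
apply: (@measure_fiberwise _ _ _ _ _ _ mu mu id id) => // y.
rewrite mul0e; have [Ay|nAy] := pselect (A y).
  apply: (@subset_measure0 _ _ _ mu _ [set y]) => //.
  by rewrite [LHS]point_massE A0.
have -> : A `&` id @^-1` [set y] = set0.
  by apply/seteqP; split=> [z [Az /= zy]|//]; apply: nAy; rewrite -zy.
exact: measure0.
Qed.

Lemma exists_point_mass_gt0 : exists a, 0 < point_mass a.
Proof.
apply: contrapT => no; have : mu setT = 0%E.
  apply: null_of_point_masses => x _; apply/eqP.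
  rewrite eq_le point_mass_ge0 andbT leNgt.
  by apply/negP => x0; apply: no; exists x.
by rewrite probability_setT => /eqP; rewrite onee_eq0.
Qed.

(** More than [c^-1] such points would have total mass above 1. *)
Lemma finite_set_point_mass_ge (c : R) :
  0 < c -> finite_set [set x | c <= point_mass x].
Proof.
move=> c_gt0; apply: contrapT.
move=> /(infinite_set_fset (Num.truncn c^-1).+1)[B Bc nB].
have le_mu (s : seq G) : uniq s -> [set` s] `<=` [set` B] ->
    (((size s)%:R * c)%:E <= mu [set` s])%E.
  elim: s => [|x s IH] /=; first by rewrite mul0r.
  move=> /andP[xs us] sB.
  have -> : [set` x :: s] = [set x] `|` [set` s].
    apply/seteqP; split=> z /=; rewrite inE.
      by move=> /orP[/eqP ->|zs]; [left|right].
    by move=> [->|zs]; rewrite ?eqxx//; apply/orP; right.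
  rewrite measureU//; last first.
    by apply/seteqP; split=> [z [/= ->]|//]; apply/negP.
  rewrite -natr1 mulrDl mul1r EFinD addeC leeD//.
    by rewrite [leRHS]point_massE lee_fin; apply/Bc/sB => /=; rewrite mem_head.
  by apply: IH => // z zs; apply: sB => /=; rewrite inE [_ \in _]zs orbT.
have := le_trans (le_mu _ (fset_uniq B) (@subset_refl _ _)) (probability_le1 mu _).
rewrite lee_fin => /(_ Logic.I); apply/negP; rewrite -ltNge.
rewrite -ltr_pdivrMr// mul1r (lt_le_trans (truncnS_gt _))// ler_nat.
exact: nB.
Qed.
End PointMass.

Lemma zmod_closed_setP (K : set X) :
  zmod_closed [in K] <-> K 0 /\ forall x y, K x -> K y -> K (x - y).
Proof.
split=> -[K0 KB]; split; first by move: K0; rewrite inE.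
- by move=> x y Kx Ky; have := KB x y; rewrite !inE; exact.
- by rewrite inE.
- by move=> x y; rewrite !inE; exact: KB.
Qed.

(** The Haar distribution is [mu] translated back by [a]. Its subgroup is
    finite because each of its points carries the mass of [a]. *)
Lemma idempotent_of_constant_on_coset (mu : probability G R) (a : G)
    (K := [set u | 0 < point_mass mu (a + u)]) :
    0 < point_mass mu a -> zmod_closed [in K] ->
    (forall u, K u -> point_mass mu (a + u) = point_mass mu a) ->
  idempotent_distribution mu.
Proof.
move=> fa_gt0 Kzmod fK.
have mshift : measurable_fun [set: G] (fun y : G => - a + y) by [].
pose shift : {mfun G >-> G} :=
  HB.pack (fun y : G => - a + y) (isMeasurableFun.Build _ _ _ _ _ mshift).
exists K, (distribution mu shift), a; split.
- split=> //; apply: finite_compact.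
  have := finite_image (fun y => - a + y) (finite_set_point_mass_ge mu fa_gt0).
  apply: sub_finite_set => u Ku; exists (a + u); last by rewrite addKr.
  by rewrite /= fK.
- split.
    rewrite -[LHS]/(mu (shift @^-1` K)) -[_ @^-1` _]setCK probability_setC//.
    rewrite [X in (_ - X)%E]null_of_point_masses ?sube0// => y.
    rewrite /= /K /= addNKr => /negP.
    by rewrite -leNgt => f_le0; apply/eqP; rewrite eq_le f_le0 point_mass_ge0.
  move=> x A Kx AK _; rewrite -[RHS]mul1e.
  (* Compare the two sets point by point along the bijection [z |-> x + z]. *)
  apply: (@measure_fiberwise _ _ _ _ _ _ mu mu id (fun y => x + y)) => // y.
  rewrite mul1e.
  have [[k Ak kE]|ny] := pselect ([set x + k | k in A] (- a + y)).
    have yE : y = a + (x + k) by rewrite kE addNKr.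
    have -> : shift @^-1` [set x + k | k in A] `&` id @^-1` [set y] = [set y].
      by apply/seteqP; split=> [z []|z ->]//; split=> //; exists k.
    have -> : shift @^-1` A `&` (fun z => x + z) @^-1` [set y] = [set a + k].
      apply/seteqP; split=> [z [_ /= zE]|z -> /=].
        by apply: (addrI x); rewrite zE yE addrCA.
      by rewrite addKr yE addrCA.
    rewrite [LHS]point_massE [RHS]point_massE yE !fK//; first exact: AK.
    have /zmod_closed_setP[K0 KB] := Kzmod.
    by rewrite -[k]opprK -[- k]add0r; exact: (KB _ _ Kx (KB _ _ K0 (AK _ Ak))).
  have -> : shift @^-1` [set x + k | k in A] `&` id @^-1` [set y] = set0.
    by apply/seteqP; split=> [z [/= zA zy]|//]; apply: ny; rewrite -zy.
  have -> : shift @^-1` A `&` (fun z => x + z) @^-1` [set y] = set0.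
    apply/seteqP; split=> [z [/= zA zy]|//]; apply: ny.
    by exists (- a + z) => //; rewrite -zy addrCA.
  by rewrite !measure0.
- move=> A _; rewrite /pushforward /distribution /pushforward.
  by congr (mu _); apply/seteqP; split=> y /=; rewrite addNKr.
Qed.

(** Invariance gives all points of [K] the mass of 0 under the Haar
    distribution, and [m K = 1] leaves no mass outside [K]. *)
Lemma point_mass_of_idempotent (mu : probability G R) : idempotent_distribution mu ->
  exists (K : set G) (a : G) (c : R), [/\ K 0,
    forall x y, K x -> K y -> K (x - y) &
    forall x, point_mass mu x = c * `[< K (x - a) >]%:R].
Proof.
move=> [K [m [a [[/zmod_closed_setP[K0 KB] _] [mK minv] muE]]]].
exists K, a, (point_mass m 0); split=> // x.
have -> : point_mass mu x = point_mass m (x - a).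
  rewrite /point_mass muE// /pushforward; congr (fine (m _)).
  apply/seteqP; split=> y /= => [<-|->]; first by rewrite addrC addKr.
  by rewrite addrC subrK.
case: asboolP => [Kx|nKx].
  rewrite mulr1 /point_mass -(minv (x - a) [set 0])//; last by move=> z ->.
  by rewrite image_set1 addr0.
rewrite mulr0; apply: EFin_inj; rewrite -point_massE.
apply: (@subset_measure0 _ _ _ m _ (~` K)) => //; first by move=> z ->.
by rewrite [LHS]probability_setC// mK subee.
Qed.

(** * Sum and difference of two independent copies *)

Section IndependentPair.
Context d (T : measurableType d) (P : probability T R).
Variables (xi eta : {RV P >-> G}) (mu : probability G R).
Hypothesis xi_eta_indep : independent_RVs P xi eta.
Hypothesis xi_mu : forall A, measurable A -> distribution P xi A = mu A.
Hypothesis eta_mu : forall A, measurable A -> distribution P eta A = mu A.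

Let mxi A : measurable (xi @^-1` A).
Proof. by rewrite -[_ @^-1` _]setTI; exact: measurable_funP. Qed.

Let meta A : measurable (eta @^-1` A).
Proof. by rewrite -[_ @^-1` _]setTI; exact: measurable_funP. Qed.

Let mfun2 (Y : Type) (phi : G -> G -> Y) (A : set Y) :
  measurable ((fun w => phi (xi w) (eta w)) @^-1` A).
Proof.
exact: (@measurable_preimage2 _ _ _ xi eta [set z | A (phi z.1 z.2)]).
Qed.

Lemma joint_law_at x y :
  P (xi @^-1` [set x] `&` eta @^-1` [set y]) =
  (point_mass mu x * point_mass mu y)%:E.
Proof.
by rewrite xi_eta_indep// EFinM -!point_massE; congr (_ * _)%E;
  [exact: xi_mu|exact: eta_mu].
Qed.

(** With [g] and [h] the point masses of [S] and [D], independence reads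
    [f(x)^2 = g(2 x) h(0)] and [2 f(x) f(y) = g(x + y) h((x - y)^2)] for
    [x <> y]. Both sides of the equation, doubled, are the same product
    [g(2 a + 2 u) h(4 v^2) g(2 a) h(0)] when [v != 0]. *)
Lemma point_mass_functional_equation a u v : 2%:R != 0 :> G ->
    independent_RVs P (fun w => xi w + eta w) (fun w => (xi w - eta w) ^+ 2) ->
  point_mass mu (a + (u + v)) * point_mass mu (a + (u - v)) *
    point_mass mu (a + 0) ^+ 2 =
  point_mass mu (a + u) ^+ 2 *
    (point_mass mu (a + v) * point_mass mu (a - v)).
Proof.
move=> two_neq0 SD_indep.
pose g (s : G) := fine (P ((fun w => xi w + eta w) @^-1` [set s])).
pose h (t : G) := fine (P ((fun w => (xi w - eta w) ^+ 2) @^-1` [set t])).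
have ghE x y : P ((fun w => xi w + eta w) @^-1` [set x + y] `&`
    (fun w => (xi w - eta w) ^+ 2) @^-1` [set (x - y) ^+ 2]) =
    (g (x + y) * h ((x - y) ^+ 2))%:E.
  rewrite SD_indep// EFinM /g /h !fineK// fin_num_measure//.
  exact: (mfun2 (fun x y => (x - y) ^+ 2)).
have diag x : point_mass mu x ^+ 2 = g (x + x) * h 0.
  apply: EFin_inj; have := ghE x x; rewrite subrr expr0n /= => <-.
  rewrite expr2 -joint_law_at; congr (P _); apply/seteqP; split=> w /=.
    by move=> [-> ->]; rewrite subrr expr0n.
  move=> [sE dE]; have [] := sum_sqdiff_inj two_neq0 sE (_ : _ = (x - x) ^+ 2).
  - by rewrite dE subrr expr0n.
  - by [].
  - by [].
have off x y : x <> y ->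
    2%:R * (point_mass mu x * point_mass mu y) = g (x + y) * h ((x - y) ^+ 2).
  move=> xy; apply: EFin_inj; rewrite -ghE.
  have -> : (fun w => xi w + eta w) @^-1` [set x + y] `&`
      (fun w => (xi w - eta w) ^+ 2) @^-1` [set (x - y) ^+ 2] =
      (xi @^-1` [set x] `&` eta @^-1` [set y]) `|`
      (xi @^-1` [set y] `&` eta @^-1` [set x]).
    apply/seteqP; split=> w /=.
      case=> sE dE; exact: (sum_sqdiff_inj two_neq0 sE dE).
    by move=> [] [-> ->]; split=> //; ring.
  rewrite measureU; last 3 first.
  - exact: measurableI.
  - exact: measurableI.
  - by apply/seteqP; split=> [w [[/= -> _] [/= ? _]]|//].
  by rewrite [X in (X + _)%E]joint_law_at [X in (_ + X)%E]joint_law_at -EFinD;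
    congr EFin; ring.
have [->|v_neq0] := eqVneq v 0; first by rewrite !(addr0, subr0); ring.
have neq b : b + v <> b - v.
  move=> /addrI vE; case/negP: v_neq0; apply/eqP/(double_inj two_neq0).
  by rewrite {2}vE subrr addr0.
have two_neq0' : 2%:R != 0 :> R by [].
have off_u := off _ _ (neq (a + u)); have off_0 := off _ _ (neq a).
have sum_u : a + u + v + (a + u - v) = a + u + (a + u) by ring.
have sum_0 : a + v + (a - v) = a + a by ring.
have diff_u : a + u + v - (a + u - v) = a + v - (a - v) by ring.
apply: (mulfI two_neq0'); rewrite !addrA addr0 [LHS]mulrA off_u diff_u sum_u.
by rewrite !diag [RHS]mulrCA off_0 sum_0; ring.
Qed.

(** Conditioning on [eta = y] turns [phi xi eta = s] into [xi = psi s y]. The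
    hypothesis says that this has conditional probability [r] for every [y]
    charged by [mu]; then [r] is also the unconditional probability. *)
Lemma law_of_pair_at (phi : G -> G -> G) (psi : G -> G -> G) s r :
    (forall x y, phi x y = s <-> x = psi s y) ->
    (forall y, point_mass mu (psi s y) * point_mass mu y = r * point_mass mu y) ->
  P ((fun w => phi (xi w) (eta w)) @^-1` [set s]) = r%:E.
Proof.
move=> phiE psir; rewrite -[RHS]mule1 -(probability_setT P).
apply: (@measure_fiberwise _ _ _ _ _ _ P P eta eta) => //.
move=> y; rewrite setTI [X in (_ * X)%E](@eta_mu [set y])// point_massE -EFinM -psir.
rewrite -joint_law_at; congr (P _); apply/seteqP; split=> w /= [].
  by move=> + <- => /phiE.
by move=> xE yE; split=> //; apply/phiE; rewrite yE.
Qed.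

(** The joint law of sum and difference at [(s, t)] is [c * c] when both
    [(s + t) / 2] and [(s - t) / 2] lie in [a + K], and 0 otherwise. That
    condition splits into one on [s] and one on [t], because [K] is closed
    under halving. *)
Lemma independent_sum_diff_idempotent p : p \in [pchar G] -> (2 < p)%N ->
    idempotent_distribution mu ->
  independent_RVs P (fun w => xi w + eta w) (fun w => xi w - eta w).
Proof.
move=> pX p_gt2 /point_mass_of_idempotent[K [a [c [K0 KB fE]]]].
have two_neq0 : 2%:R != 0 :> G by rewrite -(dvdn_pcharf pX) gtnNdvd.
have KN x : K x -> K (- x) by move=> Kx; rewrite -[- x]add0r; exact: KB.
have KD x y : K x -> K y -> K (x + y).
  by move=> Kx Ky; rewrite -[y]opprK; apply: KB => //; exact: KN.
have K_half x : K (x + x) -> K x.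
  move=> Kxx; have Kmul n : K ((x + x) *+ n).
    by elim: n => [|n IH]; rewrite ?mulr0n// mulrS; exact: KD.
  have p_odd : odd p.
    by case: (even_prime (pcharf_prime pX)) p_gt2 => // ->.
  (* In characteristic [p], halving is multiplication by [(p + 1) / 2]. *)
  have <- // : (x + x) *+ p.+1./2 = x.
  rewrite -mulr2n -mulrnA mul2n -[LHS]addr0 even_halfK /= ?p_odd//.
  by rewrite mulrS (mulrn_pchar pX) !addr0.
have sum_mass s : P ((fun w => xi w + eta w) @^-1` [set s]) =
    (c * `[< K (s - a - a) >]%:R)%:E.
  apply: (@law_of_pair_at (fun x y => x + y) (fun s y => s - y)).
    by move=> x y; split=> [<-|->]; rewrite ?addrK ?subrK.
  move=> y; rewrite !fE.
  case: (asboolP (K (y - a))) => [Ky|_]; last by rewrite !mulr0.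
  congr (c * (nat_of_bool _)%:R * _); apply: asbool_equiv_eq; split=> Ks.
    have -> : s - a - a = (s - y - a) + (y - a) by ring.
    exact: KD.
  have -> : s - y - a = (s - a - a) - (y - a) by ring.
  exact: KB.
have diff_mass t : P ((fun w => xi w - eta w) @^-1` [set t]) =
    (c * `[< K t >]%:R)%:E.
  apply: (@law_of_pair_at (fun x y => x - y) (fun t y => t + y)).
    by move=> x y; split=> [<-|->]; rewrite ?addrK ?subrK.
  move=> y; rewrite !fE.
  case: (asboolP (K (y - a))) => [Ky|_]; last by rewrite !mulr0.
  congr (c * (nat_of_bool _)%:R * _); apply: asbool_equiv_eq; split=> Kt.
    have -> : t = (t + y - a) - (y - a) by ring.
    exact: KB.
  have -> : t + y - a = t + (y - a) by ring.
  exact: KD.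
apply: independent_RVs_pointwise.
- by move=> A; exact: (mfun2 (fun x y => x + y)).
- by move=> A; exact: (mfun2 (fun x y => x - y)).
move=> s t; rewrite [X in (X * _)%E]sum_mass [X in (_ * X)%E]diff_mass -EFinM.
pose x := (s + t) / 2%:R; pose y := (s - t) / 2%:R.
have -> : (fun w => xi w + eta w) @^-1` [set s] `&`
    (fun w => xi w - eta w) @^-1` [set t] =
    xi @^-1` [set x] `&` eta @^-1` [set y].
  rewrite /x /y; apply/seteqP; split=> w /= [].
    by move=> <- <-; split; field.
  by move=> -> ->; split; field.
rewrite joint_law_at !fE [RHS]EFinM -EFinM; congr EFin.
rewrite mulrACA [RHS]mulrACA -!natrM !mulnb; congr (_ * _%:R).
have sE : s - a - a = (x - a) + (y - a) by rewrite /x /y; field.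
have tE : t = (x - a) - (y - a) by rewrite /x /y; field.
congr (nat_of_bool _); rewrite -!asbool_and; apply: asbool_equiv_eq.
rewrite sE tE; split=> -[Kx Ky]; first by split; [exact: KD|exact: KB].
split; apply: K_half.
  have -> : x - a + (x - a) = (x - a + (y - a)) + (x - a - (y - a)) by ring.
  exact: KD.
have -> : y - a + (y - a) = (x - a + (y - a)) - (x - a - (y - a)) by ring.
exact: KB.
Qed.
End IndependentPair.

End DiscreteField.

Theorem theorem1 (R : realType) (X : fieldType) (p : nat)
    (X_countable : countable [set: X])
    (X_char : p \in [pchar X]) (p_gt2 : (2 < p)%N)
    (d : measure_display) (T : measurableType d) (P : probability T R)
    (xi eta : {RV P >-> discrete_field X})
    (mu : probability (discrete_field X) R)
    (xi_eta_indep : independent_RVs P xi eta)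
    (xi_mu : forall A, measurable A -> distribution P xi A = mu A)
    (eta_mu : forall A, measurable A -> distribution P eta A = mu A) :
  independent_RVs P (fun w => xi w + eta w) (fun w => (xi w - eta w) ^+ 2)
    <-> idempotent_distribution mu.
Proof.
have two_neq0 : 2%:R != 0 :> discrete_field X.
  by rewrite -(dvdn_pcharf (X_char : p \in [pchar discrete_field X])) gtnNdvd.
split=> [SD_indep|mu_idem]; last first.
  have SW_indep := independent_sum_diff_idempotent X_countable
    xi_eta_indep xi_mu eta_mu X_char p_gt2 mu_idem.
  by move=> A B _ _; exact: (SW_indep A ((fun t => t ^+ 2) @^-1` B)).
have [a fa_gt0] := exists_point_mass_gt0 X_countable mu.
pose F (u : discrete_field X) := point_mass mu (a + u).
have F_ge0 u : 0 <= F u by exact: point_mass_ge0.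
have F0_gt0 : 0 < F 0 by rewrite /F addr0.
have F_eq u v := point_mass_functional_equation X_countable
  xi_eta_indep xi_mu eta_mu a u v two_neq0 SD_indep.
apply: (idempotent_of_constant_on_coset X_countable fa_gt0).
  apply/zmod_closed_setP; split=> // x y.
  exact: (functional_equation_supportB two_neq0 F_ge0 F0_gt0 F_eq).
move=> u Fu; rewrite -[a in RHS]addr0.
exact: (functional_equation_const two_neq0 F_ge0 F0_gt0 F_eq X_char).
Qed.
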